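(* Let $G$ be a 2-vertex-connected outerplanar graph and $t$ a positive integer, and let $\tilde T$, $w$, $S$ be as defined in the context. Then $G$ admits a tree $t$-spanner if and only if $\tilde T$ has a tree S-partition $\pi$ with $\mathrm{cost}(\pi)\le t-1$.
   Context: Graphs are simple, finite, connected, undirected, unweighted. $G$ is embedded (uniquely) in the plane with all vertices on the boundary of the exterior face; bounded faces are interior faces, $\mathrm{Int\text{-}faces}(G)$ their set, $E(f)$ the edge set of a face $f$. An edge is external if on the exterior face; an E-face is an interior face containing an external edge. $\tilde T$ (the weak dual) has vertex set $\{v_f: f\in\mathrm{Int\text{-}faces}(G)\}$ and edges $(v_f,v_g)$ whenever $|E(f)\cap E(g)|=1$; $w(v_f)=|E(f)|-2$; $S=\{v_f: f \text{ an E-face of } G\}$. A tree S-partition of $\tilde T$ is a partition $\pi=\{V_1,\ldots,V_{|S|}\}$ of $V(\tilde T)$ such that each $\tilde T[V_i]$ is a tree and $|V_i\cap S|=1$. $\mathrm{cost}(X)=\sum_{v\in X}w(v)$ and $\mathrm{cost}(\pi)=\max_i \mathrm{cost}(V_i)$. A tree $t$-spanner of $G$ is a spanning tree $T$ with $d_T(u,v)\le t\cdot d_G(u,v)$ for all $u,v$, where $d$ is shortest-path distance. *)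

(* Defs.v *)
From HB Require Import structures.
From mathcomp Require Import all_boot all_fingroup.
Set Implicit Arguments.
Unset Strict Implicit.
Unset Printing Implicit Defensive.

Record sgraph := SGraph {
  vertex :> finType;
  adj : rel vertex;
  adj_sym : symmetric adj;
  adj_irrefl : irreflexive adj }.

Arguments adj {s}.

Definition edges (G : sgraph) : {set {set G}} :=
  [set [set p.1; p.2] | p : G * G & adj p.1 p.2].

Definition connected (G : sgraph) : Prop :=
  0 < #|G| /\ forall x y : G, connect adj x y.

(* [ucycle] allows the degenerate cycles [x; y] running back and forth along
   an edge; genuine cycles of a simple graph have at least 3 vertices. *)
Definition acyclic (G : sgraph) : Prop :=
  forall c : seq G, ucycle adj c -> size c <= 2.

Definition is_tree (G : sgraph) : Prop := connected G /\ acyclic G.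

Definition induced (G : sgraph) (A : {set G}) : sgraph.
Proof.
refine (@SGraph {x : G | x \in A} (fun x y => adj (val x) (val y)) _ _).
- by move=> x y; apply: adj_sym.
- by move=> x; apply: adj_irrefl.
Defined.

(* The subgraph with all the vertices of G and only the edges in F. *)
Definition spanning_subgraph (G : sgraph) (F : {set {set G}}) : sgraph.
Proof.
refine (@SGraph G (fun x y => adj x y && ([set x; y] \in F)) _ _).
- by move=> x y /=; rewrite adj_sym setUC.
- by move=> x /=; rewrite adj_irrefl.
Defined.

Definition two_connected (G : sgraph) : Prop :=
  [/\ 2 < #|G|, connected G & forall x : G, connected (induced [set~ x])].

Definition walk (G : sgraph) (x y : G) (n : nat) : bool :=
  [exists p : n.-tuple G, path adj x p && (last x p == y)].

(* The least length of a walk from x to y. A shortest walk has length less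
   than #|G|; the junk value for disconnected pairs is #|G|. *)
Definition dist (G : sgraph) (x y : G) : nat := find (walk x y) (iota 0 #|G|).

Definition tree_spanner (G : sgraph) (t : nat) (F : {set {set G}}) : Prop :=
  [/\ F \subset edges G,
      is_tree (spanning_subgraph F)
    & forall u v : G,
        @dist (spanning_subgraph F) u v <= t * @dist G u v].

Definition dart (G : sgraph) : finType := {p : G * G | adj p.1 p.2}.

Definition tail (G : sgraph) (d : dart G) : G := (val d).1.
Definition head (G : sgraph) (d : dart G) : G := (val d).2.
Definition edge_of (G : sgraph) (d : dart G) : {set G} := [set tail d; head d].

Lemma rev_dart_proof (G : sgraph) (d : dart G) :
  adj (head d, tail d).1 (head d, tail d).2.
Proof. by rewrite /= adj_sym; apply: (valP d). Qed.

Definition rev_dart (G : sgraph) (d : dart G) : dart G :=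
  exist _ (head d, tail d) (rev_dart_proof d).

Lemma rev_dartK (G : sgraph) : involutive (@rev_dart G).
Proof. by move=> d; apply: val_inj => /=; case: d => -[]. Qed.

Definition rev_perm (G : sgraph) : {perm dart G} :=
  perm (can_inj (@rev_dartK G)).

(* After traversing u -> v, a facial walk leaves v along the successor of
   v -> u in the rotation at v. (Permutation products apply the left factor
   first.) *)
Definition face_perm (G : sgraph) (rot : {perm dart G}) : {perm dart G} :=
  (rev_perm G * rot)%g.

(* A face is identified with the set of darts of its facial walk. *)
Definition faces (G : sgraph) (rot : {perm dart G}) : {set {set dart G}} :=
  porbits (face_perm rot).

(* A plane embedding of a connected graph with at least one edge, up to
   homeomorphism, is a cyclic ordering of the darts leaving each vertex whose
   facial walks satisfy V - E + F = 2 (i.e. of genus 0); any face may be taken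
   as the exterior one. The embedding is outerplane if every vertex lies on
   the exterior face. *)
Record outerplane_embedding (G : sgraph) := OuterplaneEmbedding {
  rot : {perm dart G};
  rotP : forall d d' : dart G, (d' \in porbit rot d) = (tail d' == tail d);
  euler : #|G| + #|faces rot| = #|edges G| + 2;
  exterior : {set dart G};
  exterior_face : exterior \in faces rot;
  exterior_vertex : forall v : G, exists2 d, d \in exterior & tail d = v }.

Definition face_edges (G : sgraph) (f : {set dart G}) : {set {set G}} :=
  [set edge_of d | d in f].

Definition int_faces (G : sgraph) (M : outerplane_embedding G) :
  {set {set dart G}} := faces (rot M) :\ exterior M.

Definition external (G : sgraph) (M : outerplane_embedding G) (a : {set G}) :=
  a \in face_edges (exterior M).

Definition weak_dual (G : sgraph) (M : outerplane_embedding G) : sgraph.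
Proof.
refine (@SGraph {f : {set dart G} | f \in int_faces M}
  (fun f g =>
     (f != g) && (#|face_edges (val f) :&: face_edges (val g)| == 1)) _ _).
- by move=> f g; rewrite eq_sym setIC.
- by move=> f; rewrite eqxx.
Defined.

(* Faces of a 2-connected simple graph have at least 3 edges, so the
   subtraction is never truncated there. *)
Definition weight (G : sgraph) (M : outerplane_embedding G)
    (f : weak_dual M) : nat :=
  #|face_edges (val f)| - 2.

Definition E_faces (G : sgraph) (M : outerplane_embedding G) :
    {set weak_dual M} :=
  [set f : weak_dual M | [exists a in face_edges (val f), external M a]].

Definition tree_partition (H : sgraph) (S : {set H}) (P : {set {set H}}) :
    Prop :=
  [/\ partition P [set: H],
      #|P| = #|S|
    & forall A : {set H}, A \in P ->
        is_tree (induced A) /\ #|A :&: S| = 1].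

Definition set_cost (H : sgraph) (w : H -> nat) (A : {set H}) : nat :=
  \sum_(v in A) w v.

Definition partition_cost (H : sgraph) (w : H -> nat) (P : {set {set H}}) :
    nat :=
  \max_(A in P) set_cost w A.

(* Main.v *)
Require Import Defs.
From HB Require Import structures.
From mathcomp Require Import all_boot all_fingroup zify.
(* The sequence operations [rot] and [head] would shadow those of [Defs]. *)
Import Defs.

(** Work with sets of darts closed under reversal, and call such a set even at a
    vertex if it has an even number of darts there. A forest is a set without
    nonempty even subset; this makes sense both for G and for its dual
    multigraph, whose vertices are the faces. The boundary of a set of faces is
    even at every vertex of G, so the complement of a forest of G connects the
    dual, and conversely; by Euler's formula the complement of a spanning tree
    is a spanning tree of the dual. As the exterior walk visits every vertex,
    the interior edges form a forest of the dual: interior faces have no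
    repeated edge and share at most one edge.

    Given a spanning tree T, let K be a component of the interior faces under the
    edges not in T. It is joined to the exterior face by a single edge d outside
    T, and the boundary of K is d together with the path of T between the ends
    of d. Counting edges, this path has length 1 + the sum of |E(f)| - 2 over K,
    which bounds the cost of K; splitting K among its E-faces only lowers the
    cost. Conversely, a tree partition plus one external edge for each block is
    a spanning tree of the dual; an edge d outside the complementary tree T cuts
    off from the exterior a part of a single block, and the boundary of that part
    minus d is a detour in T of length at most the cost of the block plus one. *)

Set Implicit Arguments.
Unset Strict Implicit.
Unset Printing Implicit Defensive.

(** * Forests in graphs given by darts *)

Section BreadthFirst.
Variables (V : finType) (e : rel V) (S : {set V}).
Hypothesis reachS : forall x, exists2 s, s \in S & connect e x s.

(** The rank is the length of a shortest walk into [S], and the first step of such a walk lowers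
    it. *)
Lemma rank_to_set : exists (rk : V -> nat), forall x, x \notin S ->
  exists2 y, e x y & rk y < rk x.
Proof.
pose reach x n := [exists p : n.-tuple V, path e x p && (last x p \in S)].
have ex x : exists n, reach x n.
  have [s sS /connectP[p xp sp]] := reachS x.
  exists (size p); apply/existsP; exists (in_tuple p).
  by rewrite /= xp -sp.
exists (fun x => ex_minn (ex x)) => x xS.
case: (ex_minnP (ex x)) => -[|n] /existsP[p /andP[]].
  by rewrite [p]tuple0 /= (negPf xS).
case/tupleP: p => y p /= /andP[exy yp] lp _.
exists y => //; case: ex_minnP => m _; rewrite ltnS; apply.
by apply/existsP; exists p; rewrite yp.
Qed.

End BreadthFirst.

Section DartGraph.
Variables (D V : finType) (r : D -> D) (src : D -> V).
Hypothesis rK : involutive r.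
Hypothesis r_neq : forall d, r d != d.
Implicit Types (X Y Z : {set D}) (d b : D).

(** The boundary map modulo 2. In a symmetric set a loop has both its darts at the same vertex,
    hence contributes nothing. *)
Definition bdry Y v := \big[addb/false]_(d | src d == v) (d \in Y).
Definition symmetric_darts Y := forall d, (r d \in Y) = (d \in Y).
Definition link X x y := [exists d in X, (src d == x) && (src (r d) == y)].
Definition spans X := forall x y, connect (link X) x y.
(** Even sets play the part of cycles, so a symmetric forest has neither loops nor parallel
    edges. *)
Definition forest X := forall Y, Y \subset X -> symmetric_darts Y ->
  (forall v, bdry Y v = false) -> Y = set0.

Definition sdiff Y Z := [set d | (d \in Y) (+) (d \in Z)].

Lemma sdiff_symmetric Y Z :
  symmetric_darts Y -> symmetric_darts Z -> symmetric_darts (sdiff Y Z).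
Proof. by move=> sY sZ d; rewrite !inE sY sZ. Qed.

Lemma sdiff_sub X Y Z : Y \subset X -> Z \subset X -> sdiff Y Z \subset X.
Proof.
move=> /subsetP sY /subsetP sZ; apply/subsetP=> d; rewrite inE.
by case dY: (d \in Y); [move=> _; apply: sY | move=> /= /sZ].
Qed.

Lemma card_sdiff Y Z : #|sdiff Y Z| <= #|Y| + #|Z|.
Proof.
apply: (@leq_trans #|Y :|: Z|); last by rewrite -cardsUI leq_addr.
apply: subset_leq_card; apply/subsetP=> d; rewrite !inE.
by case: (d \in Y).
Qed.

Lemma sdiff_eq0 Y Z : sdiff Y Z = set0 -> Y = Z.
Proof.
by move/setP=> E; apply/setP=> d; move: (E d); rewrite !inE; do 2!case: (_ \in _).
Qed.

Lemma bdry_sdiff Y Z v : bdry (sdiff Y Z) v = bdry Y v (+) bdry Z v.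
Proof. by rewrite /bdry -big_split; apply: eq_bigr => d _; rewrite inE. Qed.

Lemma edge_symmetric d : symmetric_darts [set d; r d].
Proof.
move=> b; rewrite !inE (inj_eq (can_inj rK)) orbC; congr (_ || _).
by rewrite -(inj_eq (can_inj rK)) rK.
Qed.

Lemma edge_sub X d : symmetric_darts X -> d \in X -> [set d; r d] \subset X.
Proof. by move=> sX dX; apply/subsetP=> b /set2P[]->; rewrite ?sX. Qed.

Lemma bdry1 d v : bdry [set d] v = (src d == v).
Proof.
rewrite /bdry; case: eqP => [<-|ne].
  rewrite (bigD1 d) //= inE eqxx big1 // => b /andP[_ /negPf nb].
  by rewrite inE nb.
by apply: big1 => b /eqP sb; rewrite inE; apply/eqP => E; apply: ne; rewrite -E.
Qed.

Lemma bdry_edge d v : bdry [set d; r d] v = (src d == v) (+) (src (r d) == v).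
Proof.
rewrite -!bdry1 -bdry_sdiff; congr (bdry _ _); apply/setP=> b.
by rewrite !inE; case: (b =P d) => // ->; rewrite eq_sym (negPf (r_neq d)).
Qed.

Lemma bdry0 v : bdry set0 v = false.
Proof. by apply: big1 => d _; rewrite inE. Qed.

Lemma symmetric0 : symmetric_darts set0.
Proof. by move=> d; rewrite !inE. Qed.

Lemma link_sub X Y : X \subset Y -> subrel (link X) (link Y).
Proof.
move=> /subsetP sXY x y /existsP[d /andP[dX h]].
by apply/existsP; exists d; rewrite (sXY _ dX).
Qed.

Lemma link_dart X d : d \in X -> link X (src d) (src (r d)).
Proof. by move=> dX; apply/existsP; exists d; rewrite dX !eqxx. Qed.

Lemma linkP X x y :
  reflect (exists d, [/\ d \in X, src d = x & src (r d) = y]) (link X x y).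
Proof.
apply: (iffP existsP) => [[d /and3P[dX /eqP dx /eqP dy]]|[d [dX <- <-]]].
  by exists d.
by exists d; rewrite dX !eqxx.
Qed.

Lemma link_sym X : symmetric_darts X -> symmetric (link X).
Proof.
move=> sX x y; apply/linkP/linkP => -[d [dX dx dy]];
  by exists (r d); rewrite sX rK.
Qed.

(** The edges of the walk are added modulo 2, so the inner vertices cancel. Edges walked twice
    cancel too, whence only an inequality for the size. *)
Lemma chain X x p : symmetric_darts X -> path (link X) x p ->
  exists Y, [/\ Y \subset X, symmetric_darts Y,
    forall v, bdry Y v = (x == v) (+) (last x p == v) & #|Y| <= 2 * size p].
Proof.
move=> sX; elim: p x => [|y p IH] x /=.
  move=> _; exists set0; split; first exact: sub0set.
  - exact: symmetric0.
  - by move=> v; rewrite bdry0 addbb.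
  - by rewrite cards0.
case/andP=> /linkP[d [dX dx dy]] /IH[Y [YX sY bY cY]].
exists (sdiff [set d; r d] Y); split.
- by apply: sdiff_sub YX; apply: edge_sub.
- exact: sdiff_symmetric (edge_symmetric d) sY.
- move=> v; rewrite bdry_sdiff bdry_edge bY dx dy.
  by case: (x == v); case: (y == v); case: (last y p == v).
- apply: leq_trans (card_sdiff _ _) _.
  by rewrite cards2 mulnS; apply: leq_add cY; case: (_ != _).
Qed.

Lemma chain_connect X x y : symmetric_darts X -> connect (link X) x y ->
  exists Y, [/\ Y \subset X, symmetric_darts Y
    & forall v, bdry Y v = (x == v) (+) (y == v)].
Proof.
move=> sX /connectP[p xp ->].
by have [Y [YX sY bY _]] := chain sX xp; exists Y.
Qed.

Lemma sdiff_edge Y d : symmetric_darts Y -> d \in Y ->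
  sdiff Y [set d; r d] = Y :\: [set d; r d].
Proof.
move=> sY dY; apply/setP=> b; rewrite !inE.
case: (b =P d) => [->|_] /=; first by rewrite dY.
by case: (b =P r d) => [->|_] /=; rewrite ?sY ?dY // addbF.
Qed.

Lemma del_edge_symmetric X d :
  symmetric_darts X -> symmetric_darts (X :\: [set d; r d]).
Proof. by move=> sX b; rewrite !in_setD sX edge_symmetric. Qed.

Lemma card_edge d : #|[set d; r d]| = 2.
Proof. by rewrite cards2 eq_sym r_neq. Qed.

(** While [x] differs from [y], the boundary is odd at [x], so some dart of [Y] leaves [x]. Deleting
    its edge costs two darts and moves the condition to its other end. *)
Lemma trail Y x y : symmetric_darts Y ->
  (forall v, bdry Y v = (x == v) (+) (y == v)) ->
  exists p, [/\ path (link Y) x p, last x p = y & 2 * size p <= #|Y|].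
Proof.
have [n] := ubnP #|Y|; elim: n Y x => // n IH Y x cY sY bY.
have [<-|nxy] := eqVneq x y; first by exists [::].
have bx : bdry Y x by rewrite bY eqxx eq_sym (negPf nxy).
have [d /andP[/eqP dx dY]] : exists d, (src d == x) && (d \in Y).
  apply/existsP; move: bx; apply: contraTT; rewrite negb_exists => /forallP h.
  rewrite /bdry big1 // => d dx; move: (h d); rewrite dx /=; exact: negbTE.
have cE : #|Y| = 2 + #|Y :\: [set d; r d]|.
  have := cardsID [set d; r d] Y.
  by rewrite (setIidPr (edge_sub sY dY)) card_edge => <-.
have eE := sdiff_edge sY dY.
have [||v|p [xp lp sp]] := IH (Y :\: [set d; r d]) (src (r d)).
- by rewrite cE in cY; lia.
- exact: del_edge_symmetric.
- rewrite -eE bdry_sdiff bdry_edge bY dx.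
  by case: (x == v); case: (y == v); case: (src _ == v).
exists (src (r d) :: p); split=> //=; last by rewrite cE mulnS leq_add2l.
rewrite -dx link_dart //=; apply: sub_path xp; apply: link_sub.
exact: subsetDl.
Qed.

Lemma trail_connect Y x y : symmetric_darts Y ->
  (forall v, bdry Y v = (x == v) (+) (y == v)) -> connect (link Y) x y.
Proof. by move=> sY /trail[]// p [xp <- _]; apply/connectP; exists p. Qed.

Lemma forest_sub X Y : X \subset Y -> forest Y -> forest X.
Proof. by move=> sXY fY Z ZX; apply: fY; apply: subset_trans sXY. Qed.

(** A connection of the ends avoiding the edge would form with it a nonempty even set. *)
Lemma forest_edge_cut X d : symmetric_darts X -> forest X -> d \in X ->
  ~ connect (link (X :\: [set d; r d])) (src d) (src (r d)).
Proof.
move=> sX fX dX.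
have sX' := del_edge_symmetric d sX.
case/(chain_connect sX')=> Y [YX sY bY].
have /sdiff_eq0 E : sdiff Y [set d; r d] = set0.
  apply: fX.
  - apply: sdiff_sub; last exact: edge_sub.
    exact: subset_trans YX (subsetDl _ _).
  - by apply: sdiff_symmetric => //; apply: edge_symmetric.
  - by move=> v; rewrite bdry_sdiff bY bdry_edge addbb.
by move/subsetP: YX => /(_ d); rewrite E !inE eqxx => /(_ isT).
Qed.

Lemma spans_del X d : symmetric_darts X -> d \in X -> spans X ->
  connect (link (X :\: [set d; r d])) (src d) (src (r d)) ->
  spans (X :\: [set d; r d]).
Proof.
move=> sX dX spX con x y.
have sX' := del_edge_symmetric d sX.
apply: connect_sub (spX x y) => u v /linkP[b [bX <- <-]].
have [|nb] := boolP (b \in [set d; r d]).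
  case/set2P=> ->; rewrite ?rK //.
  by rewrite (sym_connect_sym (link_sym sX')).
by apply: connect1; apply: link_dart; rewrite inE nb.
Qed.

(** * Rooted spanning trees and the number of their edges *)

Definition parent_edges (pd : V -> D) (B : {set V}) :=
  [set d | [exists v in B, (d == pd v) || (r d == pd v)]].

(** A spanning tree rooted at [v0], given by a dart from each other vertex towards the root; the
    decreasing rank rules out cycles. *)
Definition parent_map X v0 (pd : V -> D) := exists rk : V -> nat,
  forall v, v != v0 ->
    [/\ pd v \in X, src (pd v) = v & rk (src (r (pd v))) < rk v].

Lemma parent_edgesP pd (B : {set V}) d :
  reflect (exists2 v, v \in B & d = pd v \/ r d = pd v)
    (d \in parent_edges pd B).
Proof.
rewrite inE; apply: (iffP existsP) => -[v].
  by case/andP=> vB /orP[] /eqP E; exists v; auto.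
by move=> vB [] E; exists v; rewrite vB E eqxx ?orbT.
Qed.

Lemma parent_edges_symmetric pd B : symmetric_darts (parent_edges pd B).
Proof.
move=> d; apply/idP/idP => /parent_edgesP[v vB]; rewrite ?rK => E;
  by apply/parent_edgesP; exists v; rewrite ?rK; tauto.
Qed.

(** Parent darts have distinct sources, and the rank decreases along each, so none is the reverse of
    another. *)
Lemma card_parent_edges X v0 pd (B : {set V}) :
  parent_map X v0 pd -> v0 \notin B -> #|parent_edges pd B| = 2 * #|B|.
Proof.
case=> rk pdP nB.
have Bn v : v \in B -> v != v0 by apply: contraTneq => ->.
have inj : {in B &, injective pd}.
  move=> u v uB vB E; have [_ <- _] := pdP _ (Bn _ uB).
  by rewrite E; have [_ -> _] := pdP _ (Bn _ vB).
have -> : parent_edges pd B = (pd @: B) :|: (r @: (pd @: B)).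
  apply/setP=> d; rewrite in_setU; apply/parent_edgesP/orP.
    case=> v vB [->|E]; [left|right]; first exact: imset_f.
    by rewrite -[d]rK E; do 2!apply: imset_f.
  case=> [/imsetP[v vB ->]|/imsetP[b /imsetP[v vB ->] ->]];
    by exists v => //; rewrite ?rK; auto.
rewrite cardsU (card_imset _ (can_inj rK)) (card_in_imset inj).
rewrite (_ : _ :&: _ = set0) ?cards0 ?subn0 ?mul2n ?addnn //.
apply/setP=> d; rewrite !inE; apply/negP=> /andP[/imsetP[v vB ->]].
case/imsetP=> b /imsetP[u uB ->] E.
have [_ su ru] := pdP _ (Bn _ uB); have [_ sv rv] := pdP _ (Bn _ vB).
by move: rv ru; rewrite E rK su -E sv; lia.
Qed.

Hypothesis src_surj : forall v, exists d, src d = v.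

Lemma parent_mapP X v0 : spans X -> exists pd, parent_map X v0 pd.
Proof.
move=> spX; have [|rk rkP] := @rank_to_set _ (link X) [set v0].
  by move=> x; exists v0; [rewrite inE | apply: spX].
suff [pd pdP] : exists pd : V -> D, forall v, v != v0 ->
    [/\ pd v \in X, src (pd v) = v & rk (src (r (pd v))) < rk v].
  by exists pd, rk.
apply: (@fin_all_exists _ (fun=> D) (fun v d => v != v0 ->
  [/\ d \in X, src d = v & rk (src (r d)) < rk v])) => v.
have [->|nv] := eqVneq v v0.
  by have [d _] := src_surj v0; exists d.
have [|y /linkP[d [dX dv dy]] rky] := rkP v; first by rewrite inE.
by exists d => _; rewrite dy.
Qed.

Lemma parent_edges_spans X v0 pd :
  parent_map X v0 pd -> spans (parent_edges pd [set~ v0]).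
Proof.
case=> rk pdP.
have sE := parent_edges_symmetric pd [set~ v0].
have to0 v : connect (link (parent_edges pd [set~ v0])) v v0.
  have [n] := ubnP (rk v); elim: n v => // n IH v rkv.
  have [->//|nv] := eqVneq v v0.
  have [_ sv rv] := pdP v nv.
  apply: (connect_trans (y := src (r (pd v)))); last by apply: IH; lia.
  apply: connect1; rewrite -{1}sv; apply: link_dart.
  by apply/parent_edgesP; exists v; [rewrite !inE | left].
move=> x y; apply: connect_trans (to0 x) _.
by rewrite (sym_connect_sym (link_sym sE)).
Qed.

Lemma parent_edges_sub X v0 pd : symmetric_darts X ->
  parent_map X v0 pd -> parent_edges pd [set~ v0] \subset X.
Proof.
move=> sX [rk pdP]; apply/subsetP=> d /parent_edgesP[v].
by rewrite !inE => /pdP[vX _ _] [->|E] //; rewrite -sX E.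
Qed.

(** The parent edges already span, so any further edge of [X] would have its ends joined without
    it. *)
Lemma spanning_tree_parents X v0 pd : symmetric_darts X -> forest X ->
  parent_map X v0 pd -> X = parent_edges pd [set~ v0].
Proof.
move=> sX fX pdP; apply/eqP; rewrite eqEsubset (parent_edges_sub sX pdP) andbT.
apply/subsetP=> d dX; apply: contraT => nd; case: (forest_edge_cut sX fX dX).
apply: connect_sub (parent_edges_spans pdP (src d) (src (r d))) => u v uv.
apply: connect1; apply: link_sub uv; rewrite subsetD.
rewrite (parent_edges_sub sX pdP) /= disjoint_sym disjoint_subset.
apply/subsetP=> b /set2P[]->; rewrite inE //.
by rewrite (parent_edges_symmetric pd [set~ v0] d).
Qed.

Lemma spans_subtree X : symmetric_darts X -> spans X ->
  exists Y, [/\ Y \subset X, symmetric_darts Y, spans Y & #|Y| = 2 * #|V|.-1].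
Proof.
move=> sX spX; case: (pickP (@predT V)) => [v0 _|V0].
  have [pd pdP] := parent_mapP v0 spX.
  exists (parent_edges pd [set~ v0]); split.
  - exact: parent_edges_sub pdP.
  - exact: parent_edges_symmetric.
  - exact: parent_edges_spans pdP.
  - by rewrite (card_parent_edges pdP) ?cardsC1 // !inE eqxx.
exists set0; split; rewrite ?sub0set // ?cards0.
- exact: symmetric0.
- by move=> x; have := V0 x.
- by rewrite (eq_card0 (A := V)).
Qed.

Lemma forest_card X : symmetric_darts X -> spans X -> forest X ->
  #|X| = 2 * #|V|.-1.
Proof.
move=> sX spX fX; case: (pickP (@predT V)) => [v0 _|V0].
  have [pd pdP] := parent_mapP v0 spX.
  rewrite (spanning_tree_parents sX fX pdP) (card_parent_edges pdP) ?cardsC1 //.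
  by rewrite !inE eqxx.
have -> : X = set0 by apply/setP=> d; have := V0 (src d).
by rewrite cards0 (eq_card0 (A := V)).
Qed.

(** An edge of a nonempty even subset could be deleted without losing connectivity, but what remains
    is too small to contain a spanning tree. *)
Lemma card_forest X : symmetric_darts X -> spans X -> #|X| = 2 * #|V|.-1 ->
  forest X.
Proof.
move=> sX spX cX Y YX sY bY; apply/eqP; apply: contraT => /set0Pn[d dY].
have dX := subsetP YX _ dY.
have sX' := del_edge_symmetric d sX.
have sp' : spans (X :\: [set d; r d]).
  apply: spans_del => //.
  have : connect (link (sdiff Y [set d; r d])) (src d) (src (r d)).
    apply: trail_connect => [|v].
      by apply: sdiff_symmetric => //; apply: edge_symmetric.
    by rewrite bdry_sdiff bY bdry_edge.
  apply: connect_sub => u v uv; apply: connect1; apply: link_sub uv.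
  by rewrite sdiff_edge // setSD.
have [Z [ZX _ _ cZ]] := spans_subtree sX' sp'.
have := cardsID [set d; r d] X; rewrite (setIidPr (edge_sub sX dX)) card_edge.
by have := subset_leq_card ZX; rewrite cZ -cX => le E; exfalso; lia.
Qed.

(* Rooting [C] at [v0], the edges inside [A] are the parent edges of the
   vertices of [A], except the one of [src d]. *)
Lemma card_inner_tree C v0 (A : {set V}) d : symmetric_darts C -> spans C ->
  forest C -> v0 \notin A -> d \in C -> src d \in A ->
  (forall b, b \in C -> src b \in A -> (src (r b) \notin A) = (b == d)) ->
  #|[set b in C | (src b \in A) && (src (r b) \in A)]| + 2 = 2 * #|A|.
Proof.
move=> sC spC fC nA dC dA exitA.
have [pd pdP] := parent_mapP v0 spC.
rewrite -(card_parent_edges pdP nA).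
have CE := spanning_tree_parents sC fC pdP.
have [rk pd3] := pdP.
set N := [set b in C | _].
have rdA : src (r d) \notin A by rewrite exitA.
have An v : v \in A -> v != v0 by apply: contraTneq => ->.
(* A vertex of least rank in [A] has its parent outside [A], so its parent dart leaves [A] and can
   only be [d]. *)
have pdd : pd (src d) = d.
  case: (arg_minnP rk dA) => u uA umin; have [uC su lt] := pd3 _ (An _ uA).
  have /eqP <- : pd u == d; last by rewrite su.
  rewrite -exitA ?su //; apply/negP=> /umin; lia.
have -> : parent_edges pd A = N :|: [set d; r d].
  apply/setP=> b; rewrite in_setU; apply/parent_edgesP/orP.
    move=> [v vA E]; have [pC sv _] := pd3 _ (An _ vA).
    have [rA|rA] := boolP (src (r (pd v)) \in A).
      left; rewrite inE; case: E => E.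
        by rewrite E pC sv vA rA.
      by rewrite -[b]rK E sC pC rK sv vA rA.
    move: (rA); rewrite exitA ?sv // => /eqP ed; right.
    by case: E => E; rewrite !inE -?ed -?E ?rK ?eqxx ?orbT.
  case=> [|/set2P[]->].
  - rewrite inE => /and3P[bC A1 A2].
    have := bC; rewrite {1}CE => /parent_edgesP[v]; rewrite !inE => nv E.
    by exists v => //; have [_ <- _] := pd3 _ nv; case: E => <-.
  - by exists (src d) => //; left; rewrite pdd.
  - by exists (src d) => //; right; rewrite rK pdd.
rewrite cardsU card_edge (_ : _ :&: _ = set0) ?cards0 ?subn0 //.
apply/setP=> b; rewrite in_setI in_set0; apply/negP=> /andP[].
by rewrite inE => /and3P[_ b1 b2] /set2P[] E; move: b1 b2;
  rewrite E ?rK (negPf rdA).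
Qed.
End DartGraph.

(** * Even cuts and cycles *)

Section Cut.
Variables (D V1 V2 : finType) (r s : D -> D) (src1 : D -> V1) (src2 : D -> V2).
Hypothesis rK : involutive r.
Hypothesis s_inj : injective s.
Hypothesis src1s : forall d, src1 (s d) = src1 d.
Hypothesis src2s : forall d, src2 (s d) = src2 (r d).

(** [src1] and [src2] stand for vertices and faces in either order, [s] being the rotation or the
    face permutation. A cut in one graph is thus an even set in the other. *)
Definition cut (A : {set V2}) :=
  [set d | (src2 d \in A) (+) (src2 (r d) \in A)].

Lemma cut_symmetric A : symmetric_darts r (cut A).
Proof. by move=> d; rewrite !inE rK addbC. Qed.

(* Going around a vertex, one enters and leaves [A] equally often. *)
Lemma cut_even A v : bdry src1 (cut A) v = false.
Proof.
rewrite /bdry; under eq_bigr => d _ do rewrite inE -src2s.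
rewrite big_split /= (reindex_inj s_inj) /=.
by under eq_bigl => d do rewrite src1s; rewrite addbb.
Qed.

Hypothesis src2_surj : forall v, exists d, src2 d = v.
Hypothesis transitive_darts : forall B : {set D}, symmetric_darts r B ->
  (forall d, (s d \in B) = (d \in B)) -> forall d d', d \in B -> d' \in B.

(** The cut around the component of [x] in the complement of [X] is even and lies in [X], hence is
    empty. The darts of that component are then closed under [r] and [s], so they are all the
    darts. *)
Lemma forest_cospans X : symmetric_darts r X -> forest r src1 X ->
  spans r src2 (~: X).
Proof.
move=> sX fX x y.
have sC : symmetric_darts r (~: X) by move=> d; rewrite !inE sX.
pose A := [set z | connect (link r src2 (~: X)) x z].
have cut0 : cut A = set0.
  apply: fX; [|exact: cut_symmetric|exact: cut_even].
  apply/subsetP=> d; apply: contraTT => dX.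
  have cC := sym_connect_sym (link_sym src2 rK sC).
  rewrite !inE (same_connect_r cC (y := src2 (r d))) ?addbb //.
  by apply: connect1; apply: link_dart; rewrite inE.
have eqA d : (src2 (r d) \in A) = (src2 d \in A).
  by have := in_set0 d; rewrite -cut0 inE; do 2!case: (_ \in A).
have [d0 d0x] := src2_surj x; have [d1 d1y] := src2_surj y.
have : d1 \in [set d | src2 d \in A].
  apply: (@transitive_darts _ _ _ d0).
  - by move=> d; have := eqA d; rewrite !inE.
  - by move=> d; have := eqA d; rewrite !inE src2s.
  - by rewrite !inE d0x.
by rewrite !inE d1y.
Qed.

End Cut.

(** * Acyclic graphs and forests of darts *)

Section SimpleGraphs.
Variables (D V : finType) (r : D -> D) (src : D -> V).
Hypothesis rK : involutive r.
Hypothesis r_neq : forall d, r d != d.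

(** A cycle with at least three vertices would join the ends of its first edge without using that
    edge. *)
Lemma forest_acyclic (H : sgraph) (f : H -> V) (X : {set D}) :
  injective f -> symmetric_darts r X -> forest r src X ->
  (forall x y, adj x y -> link r src X (f x) (f y)) -> acyclic H.
Proof.
move=> f_inj sX fX fadj [|x [|y [|z p]]] //= /andP[].
rewrite /= rcons_path => /and4P[xy yz zp qx] /andP[xq uq].
have yq : path adj y (z :: p) by rewrite /= yz.
have [d [dX dx dy]] := linkP _ _ _ _ _ (fadj _ _ xy).
have sX' := del_edge_symmetric rK d sX.
case: (forest_edge_cut rK r_neq sX fX dX).
rewrite dx dy (sym_connect_sym (link_sym _ rK sX')).
(* As [f] is injective, only a step between [x] and [y] can use the edge of [d]. *)
have step a b : adj a b -> (a, b) != (x, y) -> (a, b) != (y, x) ->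
    connect (link r src (X :\: [set d; r d])) (f a) (f b).
  move=> /fadj/linkP[e [eX ea eb]] n1 n2.
  apply: connect1; apply/linkP; exists e; split=> //.
  rewrite inE eX andbT; apply/negP=> /set2P[] E; subst e.
    case/eqP: n1; rewrite dx in ea; rewrite dy in eb.
    by rewrite (f_inj _ _ ea) (f_inj _ _ eb).
  case/eqP: n2; rewrite rK dx in eb; rewrite dy in ea.
  by rewrite (f_inj _ _ ea) (f_inj _ _ eb).
have walk_in a w : path adj a w -> x \notin a :: w ->
    connect (link r src (X :\: [set d; r d])) (f a) (f (last a w)).
  elim: w a => //= b w IH a /andP[ab bw].
  rewrite !inE !negb_or eq_sym => /and3P[xa xb xw].
  apply: connect_trans (step _ _ ab _ _) (IH b bw _).
  - by rewrite xpair_eqE (negPf xa).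
  - by rewrite xpair_eqE [b == x]eq_sym (negPf xb) andbF.
  - by rewrite inE negb_or xb.
apply: connect_trans (walk_in _ _ yq xq) (step _ _ qx _ _).
  rewrite xpair_eqE negb_and; apply/orP; left.
  by apply: contraNneq xq => <-; rewrite inE mem_last orbT.
rewrite xpair_eqE eqxx andbT; case/andP: uq => nyq _.
by apply: contraNneq nyq => <-; exact: mem_last.
Qed.

(** A nonempty even set still joins the ends of [d] after losing that edge; a simple path closed by
    [d] is a cycle. Lengths one and two would mean a loop or a parallel edge. *)
Lemma acyclic_forest (e : rel V) (X : {set D}) :
  (forall c, ucycle e c -> size c <= 2) -> symmetric_darts r X ->
  (forall d, src (r d) != src d) ->
  (forall d b, src d = src b -> src (r d) = src (r b) -> d = b) ->
  (forall x y, link r src X x y -> e x y) -> forest r src X.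
Proof.
move=> acyc sX loopless simple Xe Y YX sY bY.
apply/eqP; apply: contraT => /set0Pn[d dY].
have : connect (link r src (Y :\: [set d; r d])) (src (r d)) (src d).
  rewrite -(sdiff_edge sY dY); apply: trail_connect => //.
    by apply: sdiff_symmetric => //; apply: edge_symmetric.
  by move=> v; rewrite bdry_sdiff bY bdry_edge //= addbC.
case/connectP=> p0 p0P; case: (shortenP p0P) => p pP up _ lp.
have sub : subrel (link r src (Y :\: [set d; r d])) e.
  move=> x y h; apply: Xe; apply: link_sub h.
  exact: subset_trans (subsetDl _ _) YX.
have := acyc (src (r d) :: p); rewrite /ucycle up andbT /= rcons_path.
rewrite (sub_path sub pP) -lp Xe ?(link_dart _ _ (subsetP YX _ dY)) //.
move=> /(_ isT); case: p pP lp {up} => [_ /= E|a [|//] /=].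
  by have := loopless d; rewrite E eqxx.
rewrite andbT => /linkP[b [bY' b1 b2]] E _.
have E2 : b = r d by apply: simple; rewrite // rK b2 E.
by move: bY'; rewrite E2 !inE eqxx orbT.
Qed.

End SimpleGraphs.

(** * Outerplane embeddings *)

Section OuterplaneMap.
Variables (G : sgraph) (M : outerplane_embedding G).
Hypothesis connG : forall x y : G, connect adj x y.
Local Notation D := (dart G).
Local Notation r := (@rev_dart G).
Local Notation phi := (face_perm (rot M)).
Local Notation Z := (weak_dual M).
Implicit Types (d b : D) (z : Z).

(* The dual graph, with [None] standing for the exterior face. *)
Definition face_at d : option Z :=
  (insub (porbit phi d) : option {f : {set dart G} | f \in int_faces M}).
Local Notation fc := face_at.

Lemma rev_dart_neq d : r d != d.
Proof.
apply/eqP=> /(congr1 val) /=; rewrite [val d]surjective_pairing => -[E _].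
by have := valP d; rewrite /= -/(tail d) -/(head d) -[tail d]E adj_irrefl.
Qed.

Lemma tail_rev d : tail (r d) = head d. Proof. by []. Qed.

Lemma tail_neq_head d : tail (r d) != tail d.
Proof.
apply/eqP=> E; have := valP d; rewrite /= -/(tail d) -/(head d) -tail_rev E.
by rewrite adj_irrefl.
Qed.

Lemma dart_ext d b : tail d = tail b -> tail (r d) = tail (r b) -> d = b.
Proof.
move=> E1 E2; apply: val_inj.
by rewrite [val d]surjective_pairing [val b]surjective_pairing; congr (_, _).
Qed.

Lemma dart_between (x y : G) : adj x y -> exists d, tail d = x /\ tail (r d) = y.
Proof. by move=> xy; exists (exist _ (x, y) xy). Qed.

Lemma edge_of_eq d b : (edge_of d == edge_of b) = (b == d) || (b == r d).
Proof.
apply/eqP/orP => [E|[]/eqP->]; last 2 first.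
- by [].
- by rewrite /edge_of setUC.
have bd : tail b \in edge_of d by rewrite E !inE eqxx.
have hd : head b \in edge_of d by rewrite E !inE eqxx orbT.
have nb := tail_neq_head b; rewrite tail_rev in nb.
case/set2P: bd => tb; case/set2P: hd => hb.
- by rewrite tb hb eqxx in nb.
- by left; apply/eqP; apply: dart_ext.
- by right; apply/eqP; apply: dart_ext => //; rewrite rev_dartK tail_rev.
- by rewrite tb hb eqxx in nb.
Qed.

Lemma edges_darts : edges G = [set edge_of d | d in [set: D]].
Proof.
apply/setP=> a; apply/imsetP/imsetP => -[p].
  by rewrite inE => pe ->; exists (exist _ p pe).
by move=> _ ->; exists (val p); rewrite ?inE //; exact: (valP p).
Qed.

Lemma card_darts : #|{: D}| = 2 * #|edges G|.
Proof.
rewrite -cardsT -sum1_card edges_darts (partition_big_imset (@edge_of G)).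
have fiber2 a : a \in [set edge_of d | d in [set: D]] ->
    \sum_(b in [set: D] | edge_of b == a) 1 = 2.
  case/imsetP=> d _ ->; rewrite sum1_card -(card_edge rev_dart_neq d).
  by apply: eq_card => b; rewrite !inE unfold_in in_setT -edge_of_eq eq_sym.
by rewrite (eq_bigr _ fiber2) sum_nat_const mulnC.
Qed.

Lemma face_permE d : phi d = rot M (r d).
Proof. by rewrite permM permE. Qed.

Lemma tail_rot d : tail (rot M d) = tail d.
Proof. by apply/eqP; rewrite -(rotP M); exact: (mem_porbit _ 1). Qed.

Lemma tail_face_perm d : tail (phi d) = tail (r d).
Proof. by rewrite face_permE tail_rot. Qed.

Lemma face_orbit (f : {set D}) d : f \in faces (rot M) ->
  (porbit phi d == f) = (d \in f).
Proof. by case/imsetP=> b _ ->; rewrite eq_porbit_mem. Qed.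

Lemma face_at_Some d z : (fc d == Some z) = (d \in val z).
Proof.
have zf : val z \in faces (rot M) by have := valP z; rewrite in_setD1 => /andP[].
rewrite -(face_orbit d zf) /fc; case: insubP => [u _ <-|nI]; first by [].
by apply/esym/eqP=> E; move: nI; rewrite E (valP z).
Qed.

Lemma face_at_None d : (fc d == None) = (d \in exterior M).
Proof.
rewrite -(face_orbit d (exterior_face M)) /fc.
case: insubP => [u + _|]; rewrite in_setD1 imset_f ?andbT //.
  by move/negPf->.
by rewrite negbK => ->.
Qed.

Lemma face_at_perm d : fc (phi d) = fc d.
Proof. by congr insub; exact: (porbit_perm phi 1 d). Qed.

Lemma face_at_rot d : fc (rot M d) = fc (r d).
Proof. by rewrite -(face_at_perm (r d)) face_permE rev_dartK. Qed.

Lemma face_at_surj o : exists d, fc d = o.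
Proof.
case: o => [z|].
  have := valP z; rewrite in_setD1 => /andP[_ /imsetP[d _ E]].
  by exists d; apply/eqP; rewrite face_at_Some [val z]E porbit_id.
have /imsetP[d _ E] := exterior_face M.
by exists d; apply/eqP; rewrite face_at_None E porbit_id.
Qed.

Lemma tail_surj (x : G) : exists d : D, tail d = x.
Proof. by have [d _ <-] := exterior_vertex M x; exists d. Qed.

Lemma card_dual : #|{: option Z}| = #|faces (rot M)|.
Proof.
rewrite card_option card_sig (cardsD1 (exterior M) (faces _)) exterior_face.
by rewrite add1n; congr _.+1; apply: eq_card => f; rewrite !inE.
Qed.

(** Spanning trees of the graph and of its dual together have as many darts as the graph. *)
Lemma euler_darts : 2 * #|G|.-1 + 2 * #|{: option Z}|.-1 = #|{: D}|.
Proof.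
have := euler M; rewrite card_dual card_darts.
have [d _] := face_at_surj None.
have : 0 < #|G| by apply/card_gt0P; exists (tail d).
have : 0 < #|faces (rot M)|.
  by rewrite card_gt0; apply/set0Pn; exists (exterior M); apply: exterior_face.
lia.
Qed.

(** Rotation reaches all darts at a vertex, reversal passes to a neighbour, and the graph is
    connected. *)
Lemma darts_transitive (B : {set D}) : symmetric_darts r B ->
  (forall d, (rot M d \in B) = (d \in B)) -> forall d d', d \in B -> d' \in B.
Proof.
move=> sB rB d d' dB.
have orb b b' : b \in B -> tail b' = tail b -> b' \in B.
  move=> bB /eqP; rewrite -(rotP M) => /porbitP[i ->].
  elim: i => [|i IH]; first by rewrite expg0 perm1.
  by rewrite expgSr permM rB.
have /connectP[p] := connG (tail d) (tail d').
elim: p d dB => [|y p IH] d dB /=; first by move=> _ E; apply: orb dB _.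
case/andP=> /dart_between[b [b1 b2]] yp lp.
have rbB : r b \in B by rewrite sB; apply: orb dB _.
by apply: IH rbB _ _; rewrite b2.
Qed.

Lemma darts_transitive_face (B : {set D}) : symmetric_darts r B ->
  (forall d, (phi d \in B) = (d \in B)) -> forall d d', d \in B -> d' \in B.
Proof.
move=> sB fB; apply: darts_transitive => // d.
by rewrite -(rev_dartK d) -face_permE fB rev_dartK sB.
Qed.

Lemma symmetricC (X : {set D}) : symmetric_darts r X -> symmetric_darts r (~: X).
Proof. by move=> sX d; rewrite !inE sX. Qed.

(** The complement spans the dual by the cut argument, and by Euler's formula it has the size of a
    spanning tree. *)
Lemma primal_tree_cotree (X : {set D}) : symmetric_darts r X ->
  spans r (@tail G) X -> forest r (@tail G) X ->
  spans r fc (~: X) /\ forest r fc (~: X).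
Proof.
move=> sX spX fX.
have spC : spans r fc (~: X).
  apply: (forest_cospans (s := rot M) (@rev_dartK G) _
    tail_rot face_at_rot) fX => //.
  - exact: perm_inj.
  - exact: face_at_surj.
  - exact: darts_transitive.
split=> //; apply: card_forest spC _ => //.
- exact: rev_dartK.
- exact: rev_dart_neq.
- exact: face_at_surj.
- exact: symmetricC.
have E := forest_card (@rev_dartK G) rev_dart_neq tail_surj sX spX fX.
by apply/eqP; rewrite -(eqn_add2l #|X|) cardsC E euler_darts.
Qed.

Lemma dual_tree_cotree (X : {set D}) : symmetric_darts r X ->
  spans r fc X -> forest r fc X ->
  spans r (@tail G) (~: X) /\ forest r (@tail G) (~: X).
Proof.
move=> sX spX fX.
have spC : spans r (@tail G) (~: X).
  apply: (forest_cospans (s := phi) (@rev_dartK G) _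
    face_at_perm tail_face_perm) fX => //.
  - exact: perm_inj.
  - exact: tail_surj.
  - exact: darts_transitive_face.
split=> //; apply: card_forest spC _ => //.
- exact: rev_dartK.
- exact: rev_dart_neq.
- exact: tail_surj.
- exact: symmetricC.
have E := forest_card (@rev_dartK G) rev_dart_neq face_at_surj sX spX fX.
by apply/eqP; rewrite -(eqn_add2l #|X|) cardsC E addnC euler_darts.
Qed.

(** * Interior edges and the weak dual *)

Definition interior_darts : {set D} :=
  [set d | (fc d != None) && (fc (r d) != None)].
Local Notation I := interior_darts.

Lemma interior_symmetric : symmetric_darts r I.
Proof. by move=> d; rewrite !inE rev_dartK andbC. Qed.

(* The facial walk of the exterior visits every vertex, so the complement of
   the interior edges is connected. *)
Lemma interior_forest : forest r fc I.
Proof.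
have sC := symmetricC interior_symmetric.
have spC : spans r (@tail G) (~: I).
  move=> x y; have [d dE <-] := exterior_vertex M x.
  have [b bE <-] := exterior_vertex M y.
  have /porbitP[i ->] : b \in porbit phi d.
    have /imsetP[d0 _ E] := exterior_face M.
    by move: dE bE; rewrite E -eq_porbit_mem => /eqP->.
  elim: i => [|i IH]; first by rewrite expg0 perm1.
  apply: connect_trans IH _; apply: connect1; rewrite expgSr permM tail_face_perm.
  apply: link_dart; rewrite !inE negb_and negbK.
  suff -> : fc ((phi ^+ i)%g d) = fc d by rewrite face_at_None dE.
  elim: i => [|i IH]; first by rewrite expg0 perm1.
  by rewrite expgSr permM face_at_perm.
(* A spanning tree avoiding [I] has a dual forest as its complement, which contains [I]. *)
have [Y [YC sY spY cY]] :=
  spans_subtree (@rev_dartK G) tail_surj sC spC.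
have [|_ fY] := primal_tree_cotree sY spY.
  exact: (card_forest (@rev_dartK G) rev_dart_neq tail_surj sY spY cY).
by apply: forest_sub fY; rewrite -setCS setCK.
Qed.

Lemma interior_loopless d : d \in I -> fc (r d) != fc d.
Proof.
move=> dI; apply/eqP=> E; have := set21 d (r d).
rewrite (_ : [set d; r d] = set0) ?inE //; apply: interior_forest.
- exact: edge_sub interior_symmetric dI.
- exact: edge_symmetric (@rev_dartK G) d.
- by move=> v; rewrite bdry_edge ?E ?addbb //; exact: rev_dart_neq.
Qed.

Lemma interior_simple d b : d \in I -> b \in I ->
  fc d = fc b -> fc (r d) = fc (r b) -> d = b.
Proof.
move=> dI bI E1 E2.
have /sdiff_eq0/setP/(_ d) : sdiff [set d; r d] [set b; r b] = set0.
  apply: interior_forest.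
  - by apply: sdiff_sub; apply: edge_sub interior_symmetric _.
  - by apply: sdiff_symmetric; exact: edge_symmetric (@rev_dartK G) _.
  - move=> v; rewrite bdry_sdiff !bdry_edge ?E1 ?E2 ?addbb //; exact: rev_dart_neq.
rewrite !inE eqxx /= => /esym/orP[/eqP//|/eqP E].
by have := interior_loopless bI; rewrite -E E1 eqxx.
Qed.

Lemma in_interior d z z' : d \in val z -> r d \in val z' -> d \in I.
Proof. by rewrite -!face_at_Some inE => /eqP-> /eqP->. Qed.

(** An edge met twice by the facial walk would be a loop of the dual. *)
Lemma card_face_edges z : #|face_edges (val z)| = #|val z|.
Proof.
apply: card_in_imset => d b dz bz /eqP; rewrite edge_of_eq.
case/orP=> /eqP E //; rewrite E in bz.
have := interior_loopless (in_interior dz bz).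
by move: dz bz; rewrite -!face_at_Some => /eqP-> /eqP->; rewrite eqxx.
Qed.

(** Consecutive darts of a facial walk have different tails. Hence the subtraction in [weight] is
    never truncated. *)
Lemma card_face_ge2 z : 2 <= #|val z|.
Proof.
have [d /eqP] := face_at_surj (Some z); rewrite face_at_Some => dz.
have dz' : phi d \in val z by rewrite -face_at_Some face_at_perm face_at_Some.
have -> : 2 = #|[set d; phi d]|.
  rewrite cards2; case: eqP => // E.
  by have := tail_neq_head d; rewrite -tail_face_perm -E eqxx.
by apply: subset_leq_card; apply/subsetP=> b /set2P[]->.
Qed.

(** Without dual loops, faces sharing an interior edge are distinct; without parallel ones, they
    share no second edge. *)
Lemma weak_dualP (z z' : Z) :
  reflect (exists d, d \in val z /\ r d \in val z') (adj z z').
Proof.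
have neq d b : edge_of d = edge_of b -> d \in val z -> b \in val z' -> z != z' ->
    b = r d.
  move=> /eqP; rewrite edge_of_eq => /orP[]/eqP E // dz bz' /eqP[].
  rewrite E -face_at_Some in bz'; rewrite -face_at_Some (eqP bz') in dz.
  by case/eqP: dz.
apply: (iffP andP) => [[nz /eqP/eqP/cards1P[a /setP E]]|[d [dz dz']]].
  have := E a; rewrite !inE eqxx => /andP[/imsetP[d dz ->] /imsetP[b bz' ed]].
  by exists d; rewrite -(neq d b).
have dI := in_interior dz dz'.
have nz : z != z'.
  apply/eqP=> ez; have := interior_loopless dI.
  rewrite -face_at_Some in dz; rewrite -face_at_Some in dz'.
  by rewrite (eqP dz) (eqP dz') ez eqxx.
split=> //; apply/cards1P; exists (edge_of d); apply/setP=> a.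
rewrite !inE; apply/andP/eqP => [[/imsetP[b bz ->] /imsetP[b' bz' ed]]|->].
  have rb := neq _ _ ed bz bz' nz; rewrite rb in bz'; congr edge_of.
  apply: interior_simple => //; first exact: in_interior bz bz'.
    by move: dz bz; rewrite -!face_at_Some => /eqP-> /eqP->.
  by move: dz' bz'; rewrite -!face_at_Some => /eqP-> /eqP->.
split; first exact: imset_f.
have -> : edge_of d = edge_of (r d) by apply/eqP; rewrite edge_of_eq eqxx orbT.
exact: imset_f.
Qed.

Lemma E_facesP z :
  reflect (exists2 d, d \in val z & fc (r d) = None) (z \in E_faces M).
Proof.
rewrite inE; apply: (iffP exists_inP) => [[a /imsetP[d dz ->]]|[d dz dE]].
  case/imsetP=> b bE /eqP; rewrite edge_of_eq => /orP[]/eqP E; subst b; exists d => //.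
    by rewrite -face_at_Some in dz; rewrite -face_at_None (eqP dz) in bE.
  by apply/eqP; rewrite face_at_None.
exists (edge_of d); first exact: imset_f.
have -> : edge_of d = edge_of (r d) by apply/eqP; rewrite edge_of_eq eqxx orbT.
by apply: imset_f; rewrite -face_at_None dE.
Qed.

(** Both sides count the darts on faces of [A] and then their reverses: a dart of the cut occurs
    once, a dart with both sides in [A] twice. *)
Lemma sum_face_sizes (A : {set Z}) :
  2 * (\sum_(z in A) #|val z|) = #|cut r fc (Some @: A)| +
    2 * #|[set d | (fc d \in Some @: A) && (fc (r d) \in Some @: A)]|.
Proof.
set A' := Some @: A.
have -> : \sum_(z in A) #|val z| = #|[set d | fc d \in A']|.
  rewrite -sum1_card (partition_big fc (mem A')) /=; last by move=> d; rewrite inE.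
  rewrite big_imset /=; last by move=> ? ? _ _ [].
  apply: eq_bigr => z zA; rewrite sum1_card; apply: eq_card => d.
  rewrite -face_at_Some unfold_in inE andb_idl // => /eqP->; exact: imset_f.
set P := [set d | fc d \in A']; set Q := [set d | fc (r d) \in A'].
have cPQ : #|Q| = #|P|.
  rewrite -(card_imset P (can_inj (@rev_dartK G))); apply: eq_card => d.
  rewrite inE; apply/idP/imsetP => [h|[b + ->]]; last by rewrite inE rev_dartK.
  by exists (r d); rewrite ?inE ?rev_dartK.
have -> : [set d | (fc d \in A') && (fc (r d) \in A')] = P :&: Q.
  by apply/setP=> d; rewrite !inE.
have -> : cut r fc A' = (P :\: Q) :|: (Q :\: P).
  by apply/setP=> d; rewrite !inE; do 2!case: (_ \in A').
rewrite cardsU (_ : _ :&: _ = set0); last first.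
  by apply/setP=> d; rewrite !inE; do 2!case: (_ \in A').
have := cardsID Q P; have := cardsID P Q; rewrite setIC cards0 cPQ; lia.
Qed.

End OuterplaneMap.

(** * Spanners and partitions *)

(** Each vertex follows rank-decreasing parents until it meets [S]; all vertices on the way get the
    same owner, which keeps the fibres connected. *)
Lemma owner_map (V : finType) (e : rel V) (S : {set V}) :
  (forall x, exists2 s, s \in S & connect e x s) ->
  exists own : V -> V, [/\ forall x, own x \in S, {in S, forall s, own s = s}
    & forall x, connect [rel a b | e a b && (own b == own a)] x (own x)].
Proof.
move=> reachS; have [rk rkP] := rank_to_set reachS.
have [par parP] : exists par : V -> V, forall x,
    if x \in S then par x = x else e x (par x) && (rk (par x) < rk x).
  apply: (@fin_all_exists _ (fun=> V) (fun x y =>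
    if x \in S then y = x else e x y && (rk y < rk x))) => x.
  case: (boolP (x \in S)) => [_|/rkP[y exy lt]]; first by exists x.
  by exists y; apply/andP.
have fixS s : s \in S -> par s = s by move=> sS; have := parP s; rewrite sS.
have iter_inS n x : rk x <= n -> iter n par x \in S.
  elim: n x => [|n IH] x le.
    by have := parP x; case: ifP => //= _; lia.
  have := parP x; case: ifP => [xS _|_ /andP[_ lt]].
    by rewrite iter_fix // fixS.
  by rewrite iterSr; apply: IH; lia.
(* Elements of [S] are fixed by [par], so the largest rank is a sufficient number of iterations for
   all vertices at once. *)
pose N := \max_x rk x.
have leN x : rk x <= N by apply: leq_bigmax.
exists (iter N par); split=> [x|s sS|x].
- exact: iter_inS.
- by rewrite iter_fix // fixS.
have [n] := ubnP (rk x); elim: n x => // n IH x lt.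
have := parP x; case: ifP => [xS _|_ /andP[exp ltp]].
  by rewrite iter_fix ?fixS.
have own_par : iter N par (par x) = iter N par x.
  by rewrite -iterSr iterS fixS // iter_inS.
rewrite -own_par; apply: connect_trans (IH _ _); last by lia.
by apply: connect1; rewrite /= exp own_par eqxx.
Qed.

Lemma connect_closed (V : finType) (e : rel V) (A : {set V}) x y :
  (forall a b, a \in A -> e a b -> b \in A) ->
  connect e x y -> x \in A -> y \in A.
Proof.
move=> clA /connectP[p + ->]; elim: p x => //= a p IH x /andP[xa ap] xA.
exact: IH ap (clA _ _ xA xa).
Qed.

Lemma connect_map (V W : finType) (e : rel V) (e' : rel W) (f : V -> W) x y :
  (forall a b, e a b -> connect e' (f a) (f b)) ->
  connect e x y -> connect e' (f x) (f y).
Proof.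
move=> fe /connectP[p + ->]; elim: p x => //= a p IH x /andP[xa ap].
exact: connect_trans (fe _ _ xa) (IH _ ap).
Qed.

Lemma induced_connect (H : sgraph) (A : {set H}) (u v : induced A) :
  connect [rel a b | adj a b && (b \in A)] (val u) (val v) ->
  connect (@adj (induced A)) u v.
Proof.
case/connectP=> p; elim: p u => [|a p IH] u /=.
  by move=> _ /val_inj->.
case/andP=> /andP[ua aA] ap lp.
pose w : induced A := exist _ a aA.
apply: (connect_trans (y := w)); last exact: IH.
exact: connect1.
Qed.

Lemma dist_le (H : sgraph) (x y : H) n : walk x y n -> dist x y <= n.
Proof.
(* From [#|H|] on the bound is automatic, as [find] never exceeds the length of the list. *)
move=> w; rewrite /dist; have [lt|ge] := ltnP n #|H|; last first.
  by apply: leq_trans ge; rewrite -[X in _ <= X](size_iota 0) find_size.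
rewrite leqNgt; apply/negP=> /(before_find 0).
by rewrite nth_iota // add0n w.
Qed.

Lemma walkP (H : sgraph) (x y : H) n :
  reflect (exists p, [/\ path adj x p, last x p = y & size p = n]) (walk x y n).
Proof.
apply: (iffP existsP) => [[p /andP[xp /eqP lp]]|[p [xp lp sp]]].
  by exists p; rewrite size_tuple.
have sp' : size p == n by rewrite sp.
by exists (Tuple sp'); rewrite /= xp lp eqxx.
Qed.

Lemma dist_walk (H : sgraph) (x y : H) : connect adj x y -> walk x y (dist x y).
Proof.
case/connectP=> p0 p0P lp0; case: (shortenP p0P) lp0 => p xp up _ lp.
have h : has (walk x y) (iota 0 #|H|).
  apply/hasP; exists (size p); last by apply/walkP; exists p.
  rewrite mem_iota leq0n add0n; have /= <- := card_uniqP up.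
  exact: max_card.
have := nth_find 0 h; rewrite nth_iota ?add0n //.
by rewrite -[X in _ < X](size_iota 0) -has_find.
Qed.

Section Spanners.
Variables (G : sgraph) (M : outerplane_embedding G).
Hypothesis connG : forall x y : G, connect adj x y.
Local Notation D := (dart G).
Local Notation r := (@rev_dart G).
Local Notation tl := (@tail G).
Local Notation Z := (weak_dual M).
Local Notation fc := (@face_at G M).
Local Notation I := (interior_darts M).
Local Notation rK := (@rev_dartK G).
Local Notation rN := (@rev_dart_neq G).
Implicit Types (d b : D) (z : Z) (F : {set {set G}}).

Definition darts_of F : {set D} := [set d | edge_of d \in F].

Lemma darts_of_symmetric F : symmetric_darts r (darts_of F).
Proof. by move=> d; rewrite !inE /edge_of setUC. Qed.

Lemma link_darts_of F :
  link r tl (darts_of F) =2 @adj (spanning_subgraph F).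
Proof.
move=> x y; apply/linkP/andP => [[d [dF <- <-]]|[xy xyF]].
  by split; [exact: (valP d) | rewrite inE in dF].
by exists (exist _ (x, y) xy); rewrite inE.
Qed.

Lemma spanning_tree_darts F : is_tree (spanning_subgraph F) ->
  spans r tl (darts_of F) /\ forest r tl (darts_of F).
Proof.
case=> [[_ con] acyc]; split.
  by move=> x y; rewrite (eq_connect (link_darts_of F)); apply: con.
apply: (acyclic_forest rK rN acyc) => [||d b|x y].
- exact: darts_of_symmetric.
- exact: tail_neq_head.
- by move=> E1 E2; apply: dart_ext.
- by rewrite link_darts_of.
Qed.

Lemma darts_spanning_tree F :
  spans r tl (darts_of F) -> forest r tl (darts_of F) ->
  is_tree (spanning_subgraph F).
Proof.
move=> sp fF; split.
  split; last by move=> x y; rewrite -(eq_connect (link_darts_of F)); apply: sp.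
  have [d _] := face_at_surj (None : option Z).
  by apply/card_gt0P; exists (tail d).
apply: (@forest_acyclic _ _ r tl rK rN (spanning_subgraph F) (fun x => x)
  _ _ _ fF) => //.
  exact: darts_of_symmetric.
by move=> x y; rewrite link_darts_of.
Qed.

Lemma weight_card (A : {set Z}) :
  set_cost (@weight G M) A + 2 * #|A| = \sum_(z in A) #|val z|.
Proof.
rewrite mulnC -sum_nat_const -big_split /=; apply: eq_bigr => z _.
by rewrite /weight card_face_edges // subnK // card_face_ge2.
Qed.

(** * From a spanner to a partition *)

Section SpannerToPartition.
Variables (X : {set D}) (t : nat).
Hypothesis sX : symmetric_darts r X.
Hypothesis spX : spans r tl X.
Hypothesis fX : forest r tl X.
Hypothesis stretch : forall d, exists p,
  [/\ path (link r tl X) (tl d) p, last (tl d) p = tl (r d) & size p <= t].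

(** [C] is a spanning tree of the dual, and the classes of [e] are the components left when the
    exterior face is removed from it. *)
Let C := ~: X.
Let CI := C :&: I.
Let e : rel Z := fun z z' => link r fc CI (Some z) (Some z').

Let sC : symmetric_darts r C := symmetricC sX.
Let sCI : symmetric_darts r CI.
Proof. by move=> d; rewrite !in_setI sC interior_symmetric. Qed.
Let spC : spans r fc C := (primal_tree_cotree M connG sX spX fX).1.
Let fC : forest r fc C := (primal_tree_cotree M connG sX spX fX).2.

Lemma e_step d z z' : d \in C -> fc d = Some z -> fc (r d) = Some z' -> e z z'.
Proof.
move=> dC dz dz'; apply/linkP; exists d; split=> //.
by rewrite in_setI dC inE dz dz'.
Qed.

(** Otherwise the component of [z0] would be closed in [C], although [C] connects it to the exterior
    face. *)
Lemma exit_dart z0 : exists z d,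
  [/\ connect e z0 z, d \in C, fc d = Some z & fc (r d) = None].
Proof.
pose out z := [exists d in C, (fc d == Some z) && (fc (r d) == None)].
have [/exists_inP[z zK /exists_inP[d dC /andP[/eqP dz /eqP dN]]]|no] :=
  boolP [exists z in connect e z0, out z]; first by exists z, d.
suff : None \in Some @: [set z | connect e z0 z] by case/imsetP.
apply: connect_closed (spC (Some z0) None) _; last by apply: imset_f; rewrite inE.
move=> a b /imsetP[z]; rewrite inE => zK -> /linkP[d [dC dz <-]].
case E: (fc (r d)) => [z'|]; last first.
  case/negP: no; apply/exists_inP; exists z => //.
  by apply/exists_inP; exists d => //; rewrite dz E !eqxx.
by apply: imset_f; rewrite inE; apply: connect_trans zK (connect1 (e_step dC dz E)).
Qed.

(** The component has [k] faces, hence [2k - 2] inner darts, and [sum_face_sizes] becomes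
    [2 * cost + 4 = c] with [c] the size of its cut. The cut is [d] with a tree path of length at
    most [t], so [c <= 2t + 2]. *)
Lemma component_cost z0 :
  set_cost (@weight G M) [set z | connect e z0 z] <= t - 1.
Proof.
set K := [set z | _].
have [z1 [d [K1 dC dz1 dN]]] := exit_dart z0.
set A := Some @: K.
have AE z : (Some z \in A) = connect e z0 z.
  by rewrite mem_imset ?inE // => ? ? [].
have NA : None \notin A by apply/imsetP=> -[].
have e_sym : symmetric e by move=> z z'; exact: (link_sym fc rK sCI).
have connA o o' : o \in A -> o' \in A -> connect (link r fc CI) o o'.
  case: o => [a|]; last by rewrite (negPf NA).
  case: o' => [a'|]; last by rewrite (negPf NA).
  rewrite !AE => Ka Kb; apply: (connect_map (e := e)).
    by move=> u v uv; apply: connect1.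
  by apply: connect_trans Kb; rewrite (sym_connect_sym e_sym).
have stayA b z : b \in C -> fc b \in A -> fc (r b) = Some z -> Some z \in A.
  case E: (fc b) => [y|]; last by rewrite (negPf NA).
  by rewrite !AE => bC Ky Ez; apply: connect_trans Ky (connect1 (e_step bC E Ez)).
have dA : fc d \in A by rewrite dz1 AE.
(* Two exits, joined inside the component and closed through the exterior face, would form a
   nonempty even set in [C]. *)
have exitA b : b \in C -> fc b \in A -> (fc (r b) \notin A) = (b == d).
  move=> bC bA; apply/idP/eqP => [nA|->]; last by rewrite dN.
  have bN : fc (r b) = None.
    by case E: (fc (r b)) nA => [z|] //; rewrite (stayA _ _ bC bA E).
  have [Y [YC sY bY]] := chain_connect rK rN sCI (connA _ _ dA bA).
  have /sdiff_eq0/setP/(_ d) : sdiff Y (sdiff [set d; r d] [set b; r b]) = set0.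
    apply: fC.
    - apply: sdiff_sub; first exact: subset_trans YC (subsetIl _ _).
      by apply: sdiff_sub; apply: edge_sub.
    - by do !apply: sdiff_symmetric => //; exact: (edge_symmetric rK).
    - move=> v; rewrite !bdry_sdiff bY !bdry_edge; try exact: rN.
      by rewrite bN dN; case: (fc d == v); case: (fc b == v); case: (None == v).
  rewrite !inE eqxx.
  have -> : (d \in Y) = false.
    apply/negP=> /(subsetP YC); rewrite in_setI => /andP[_].
    by rewrite inE dN andbF.
  case: (d =P r b) => [E|_]; last by rewrite orbF /=; case: eqP => [->|].
  by have := dz1; rewrite E bN.
have inner := card_inner_tree rK rN (@face_at_surj _ M) sC spC fC NA dC dA exitA.
(* A tree edge with both sides in the component would close a cycle of interior edges, against
   [interior_forest]. *)
have NC : [set b | (fc b \in A) && (fc (r b) \in A)] =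
    [set b in C | (fc b \in A) && (fc (r b) \in A)].
  apply/setP=> b; rewrite !inE.
  case bA: (fc b \in A); case rbA: (fc (r b) \in A); rewrite ?andbF //= andbT.
  apply/esym/negP=> bX.
  have bI : b \in I.
    by rewrite inE; apply/andP; split; [move: bA|move: rbA]; apply: contraTneq => ->.
  have [Y [YC sY bY]] := chain_connect rK rN sCI (connA _ _ bA rbA).
  have /sdiff_eq0 E : sdiff Y [set b; r b] = set0.
    apply: (interior_forest connG (M := M)).
    - apply: sdiff_sub; first exact: subset_trans YC (subsetIr _ _).
      by apply: edge_sub bI; exact: interior_symmetric.
    - by apply: sdiff_symmetric => //; exact: (edge_symmetric rK).
    - by move=> v; rewrite bdry_sdiff bY bdry_edge ?addbb //; exact: rN.
  have : b \in Y by rewrite E !inE eqxx.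
  by move/(subsetP YC); rewrite !inE bX.
have [p [pP lp sp]] := stretch d.
have [Y [YX sY bY cY]] := chain rK rN sX pP.
(* Outside [X] the cut has only the edge of [d]. So the cut and the tree path closed by [d] differ
   by an even subset of the tree, and coincide. *)
have /sdiff_eq0 WE : sdiff (cut r fc A) (sdiff Y [set d; r d]) = set0.
  apply: fX.
  - apply/subsetP=> b; apply: contraTT => bX.
    have bC : b \in C by rewrite inE.
    have bY' : (b \in Y) = false by apply/negP=> /(subsetP YX); rewrite (negPf bX).
    have -> : (b \in sdiff (cut r fc A) (sdiff Y [set d; r d])) =
        (b \in cut r fc A) (+) (b \in [set d; r d]) by rewrite !inE bY'.
    rewrite inE in_set2 -[b == r d](inj_eq (can_inj rK)) rK.
    have rbC : r b \in C by rewrite sC.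
    have := exitA b bC; have := exitA _ rbC; rewrite rK.
    case bA: (fc b \in A); case rbA: (fc (r b) \in A) => //=.
    + by move=> /(_ isT) <- /(_ isT) <-.
    + by move=> _ /(_ isT) <-.
    + by move=> /(_ isT) <- _; rewrite orbT.
    + move=> _ _; apply/norP; split.
        by apply: contraFneq bA => ->.
      by apply: contraFneq rbA => ->.
  - apply: sdiff_symmetric; first exact: (cut_symmetric _ rK).
    by apply: sdiff_symmetric => //; exact: (edge_symmetric rK).
  - move=> v; rewrite !bdry_sdiff bY bdry_edge; last exact: rN.
    rewrite (cut_even (s := rot M)) ?lp ?addbb //; first exact: perm_inj.
      exact: tail_rot.
    exact: face_at_rot.
have cW : #|cut r fc A| <= 2 * t + 2.
  rewrite WE; apply: leq_trans (card_sdiff _ _) _.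
  rewrite card_edge ?leq_add2r; last exact: rN.
  by apply: leq_trans cY _; rewrite leq_mul2l.
have := sum_face_sizes K; rewrite -/A NC -weight_card.
have cA : #|A| = #|K| by apply: card_imset => ? ? [].
rewrite cA in inner.
have : 0 < #|K| by apply/card_gt0P; exists z1; rewrite inE.
move: cW inner; set c := #|cut r fc A|; set n := #|[set b in C | _]|.
set k := #|K|; set w := set_cost _ _; move: c n k w => c n k w; lia.
Qed.

(** [owner_map] splits each component among its E-faces; a block is connected by construction and
    acyclic as part of the interior forest. *)
Lemma spanner_partition : exists P : {set {set Z}},
  tree_partition (E_faces M) P /\ partition_cost (@weight G M) P <= t - 1.
Proof.
have [|own [ownS ownK ownC]] := @owner_map Z e (E_faces M).
  move=> z; have [z' [d [zz' dC dz' dN]]] := exit_dart z; exists z' => //.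
  by apply/E_facesP; exists d => //; rewrite -face_at_Some dz'.
pose fib s := [set z | own z == s].
have fib_inj : {in E_faces M &, injective fib}.
  move=> s s' sS s'S /setP/(_ s); rewrite !inE (ownK _ sS) eqxx.
  by move/esym/eqP.
exists [set fib s | s in E_faces M]; split; last first.
  apply/bigmax_leqP=> A /imsetP[s sS ->].
  (* The block of [s] lies in the component of [s]. *)
  apply: leq_trans (component_cost s); rewrite /set_cost.
  rewrite [X in _ <= X](bigID (mem (fib s))) /=.
  apply: leq_trans (leq_addr _ _); apply: eq_leq; apply: eq_bigl => z.
  rewrite !inE andb_idl // => /eqP zs.
  have e_sym : symmetric e by move=> a b; exact: (link_sym fc rK sCI).
  rewrite (sym_connect_sym e_sym) -zs.
  by apply: connect_sub (ownC z) => a b /andP[ab _]; apply: connect1.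
split.
- apply/and3P; split.
  + rewrite eqEsubset subsetT; apply/subsetP=> z _; apply/bigcupP.
    by exists (fib (own z)); [apply: imset_f | rewrite inE].
  + apply/trivIsetP=> A B /imsetP[s _ ->] /imsetP[s' _ ->] ne.
    rewrite disjoint_subset; apply/subsetP=> z; rewrite !inE => /eqP zs.
    by apply: contraNneq ne => zs'; rewrite -zs -zs'.
  + apply/imsetP=> -[s sS /setP/(_ s)].
    by rewrite !inE (ownK _ sS) eqxx.
- exact: card_in_imset.
move=> A /imsetP[s sS ->]; split; last first.
  rewrite (_ : _ :&: _ = [set s]) ?cards1 //; apply/setP=> z.
  rewrite in_setI in_set1 [_ \in fib s]inE.
  by apply/andP/eqP => [[/eqP <- /ownK->]|->]; rewrite ?ownK.
split.
  have sf : s \in fib s by rewrite inE ownK.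
  pose us : induced (fib s) := exist _ s sf.
  split; first by apply/card_gt0P; exists us.
  have adj_sym' := sym_connect_sym (@adj_sym (induced (fib s))).
  have to_s x : x \in fib s -> connect [rel a b | adj a b && (b \in fib s)] x s.
    move=> xs; have := ownC x; have /eqP-> : own x == s by rewrite inE in xs.
    case/connectP=> p; elim: p x xs => [|a p IH] x xs /=; first by move=> _ ->.
    case/andP=> /andP[xa /eqP ax] ap lp.
    have as_ : a \in fib s by rewrite inE ax; rewrite inE in xs.
    apply: connect_trans (IH a as_ ap lp); apply: connect1.
    rewrite /= as_ andbT; apply/(weak_dualP connG).
    case/linkP: xa => d [_ dx da]; exists d.
    by rewrite -!face_at_Some dx da.
  have tos u : connect (@adj (induced (fib s))) u us.
    by apply: induced_connect; apply: to_s (valP u).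
  by move=> x y; apply: connect_trans (tos x) _; rewrite adj_sym'.
apply: (@forest_acyclic _ _ r fc rK rN (induced (fib s))
          (fun u => Some (val u)) _ _ (@interior_symmetric _ M)
          (@interior_forest _ M connG)).
  by move=> u v [] /val_inj.
move=> u v /(weak_dualP connG)[d [du dv]]; apply/linkP; exists d.
split; first exact: in_interior du dv.
  by apply/eqP; rewrite face_at_Some.
by apply/eqP; rewrite face_at_Some.
Qed.

End SpannerToPartition.

(** * From a partition to a spanner *)

Section PartitionToSpanner.
Variables (P : {set {set Z}}) (t : nat).
Hypothesis treeP : tree_partition (E_faces M) P.
Hypothesis costP : partition_cost (@weight G M) P <= t - 1.
Hypothesis t_gt0 : 0 < t.

Lemma exit_choice : exists xd : {set Z} -> D, forall B, B \in P ->
  [/\ exists2 z, z \in B & fc (xd B) = Some z & fc (r (xd B)) = None].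
Proof.
apply: (@fin_all_exists _ (fun=> D) (fun B d => B \in P ->
  [/\ exists2 z, z \in B & fc d = Some z & fc (r d) = None])) => B.
case: (boolP (B \in P)) => [BP|_].
  have [_ _ /(_ B BP)[_ /eqP/cards1P[s /setP/(_ s)]]] := treeP.
  rewrite in_setI in_set1 eqxx => /andP[sB /E_facesP[d ds dN]].
  exists d => _; split=> //; exists s => //.
  by apply/eqP; rewrite face_at_Some.
by have [d _] := face_at_surj (None : option Z); exists d.
Qed.

Section ExitDarts.
Variable xd : {set Z} -> D.
Hypothesis xd_in : forall B, B \in P -> exists2 z, z \in B & fc (xd B) = Some z.
Hypothesis xd_out : forall B, B \in P -> fc (r (xd B)) = None.

(** [C] will be the spanning tree of the dual. The value of [block] at [None] is harmless, as
    interior darts have no exterior side. *)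
Let block (o : option Z) := if o is Some z then pblock P z else set0.
Let exits := [set d | [exists B in P, (d == xd B) || (r d == xd B)]].
Let C := [set d in I | block (fc d) == block (fc (r d))] :|: exits.

Lemma exitsP d :
  reflect (exists2 B, B \in P & d = xd B \/ r d = xd B) (d \in exits).
Proof.
rewrite inE; apply: (iffP exists_inP) => -[B BP h]; exists B => //.
  by case/orP: h => /eqP; auto.
by apply/orP; case: h => ->; rewrite eqxx; auto.
Qed.

Let sC : symmetric_darts r C.
Proof.
move=> d; rewrite !in_setU; congr (_ || _).
  by rewrite !inE rev_dartK andbC [in RHS]andbC eq_sym [X in _ && X]andbC.
by apply/exitsP/exitsP => -[B BP h]; exists B; rewrite ?rev_dartK in h *; tauto.
Qed.

Let trivP : trivIset P.
Proof. by have [/and3P[]] := treeP. Qed.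

Let in_block z : z \in pblock P z.
Proof. by have [/and3P[/eqP cP _ _] _ _] := treeP; rewrite mem_pblock cP. Qed.

Let block_in z : pblock P z \in P.
Proof. by have [/and3P[/eqP cP _ _] _ _] := treeP; rewrite pblock_mem // cP. Qed.

(** Interior darts of [C] stay in their block, exits of other blocks start in other blocks, and
    reversed exits start at the exterior face. *)
Lemma leave_block B d z : B \in P -> d \in C -> fc d = Some z -> z \in B ->
  d != xd B -> exists2 z', z' \in B & fc (r d) = Some z'.
Proof.
move=> BP + dz zB nd; rewrite in_setU => /orP[|/exitsP[B' B'P []E]].
- rewrite inE => /andP[]; rewrite inE => /andP[_].
  case E: (fc (r d)) => [z'|] // _; rewrite dz /= => /eqP E2; exists z' => //.
  by rewrite -(def_pblock trivP BP zB) E2.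
- have [z' z'B' E'] := xd_in B'P; rewrite -E dz in E'; case: E' => E'.
  rewrite -E' in z'B'; case/eqP: nd; rewrite E; congr xd.
  by rewrite -(def_pblock trivP BP zB) -(def_pblock trivP B'P z'B').
- by have := xd_out B'P; rewrite -E rev_dartK dz.
Qed.

Lemma blocks_span : spans r fc C.
Proof.
have toN z : connect (link r fc C) (Some z) None.
  have BP := block_in z; set B := pblock P z in BP.
  have [s sB xs] := xd_in BP.
  have [_ _ /(_ B BP)[[[_ con] _] _]] := treeP.
  have zB : z \in B by apply: in_block.
  apply: (connect_trans (y := Some s)).
    have := con (exist _ z zB) (exist _ s sB).
    apply: (connect_map (f := fun u : induced B => Some (val u))).
    move=> u v /(weak_dualP connG)[d [du dv]]; apply: connect1.
    apply/linkP; exists d; split; last 2 first.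
    - by apply/eqP; rewrite face_at_Some.
    - by apply/eqP; rewrite face_at_Some.
    rewrite in_setU; apply/orP; left; rewrite inE (in_interior du dv) /=.
    move: du dv; rewrite -!face_at_Some => /eqP-> /eqP-> /=.
    by rewrite (def_pblock trivP BP (valP u)) (def_pblock trivP BP (valP v)).
  apply: connect1; apply/linkP; exists (xd B); split=> //; last exact: xd_out.
  by rewrite in_setU; apply/orP; right; apply/exitsP; exists B; auto.
have toN' o : connect (link r fc C) o None by case: o.
move=> o o'; apply: connect_trans (toN' o) _.
by rewrite (sym_connect_sym (link_sym fc rK sC)).
Qed.

(* An even set of darts of [C] cannot contain the exit of a block, because the
   rest of [C] does not lead out of the block; so it is made of interior darts. *)
Lemma blocks_forest : forest r fc C.
Proof.
move=> Y YC sY bY.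
have noexit B : B \in P -> xd B \notin Y.
  move=> BP; apply/negP=> xY; have [s sB xs] := xd_in BP.
  suff : None \in Some @: B by case/imsetP.
  have con : connect (link r fc (Y :\: [set xd B; r (xd B)])) (Some s) None.
    apply: (trail_connect rK rN); first exact: (del_edge_symmetric rK).
    move=> v; rewrite -(sdiff_edge sY xY) bdry_sdiff bY bdry_edge; last exact: rN.
    by rewrite xs xd_out.
  apply: connect_closed con (imset_f _ sB) => a a' /imsetP[z zB ->].
  case/linkP=> b [bY' bz <-]; move: bY'; rewrite !inE negb_or.
  case/andP=> /andP[nb _] bY'.
  by have [z' z'B ->] := leave_block BP (subsetP YC _ bY') bz zB nb; apply: imset_f.
apply: (@interior_forest _ M connG) => //.
apply/subsetP=> b bY'; have := subsetP YC _ bY'; rewrite in_setU.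
case/orP=> [|/exitsP[B BP h]]; first by rewrite inE => /andP[].
by case/negP: (noexit B BP); case: h => <-; rewrite ?sY.
Qed.

Let C' d := C :\: [set d; r d].

(** The faces [K] still reachable from [fc d] without [d] are bounded by [d] and a detour outside
    [C]. At least [2k - 2] darts lie inside [K], so [sum_face_sizes] gives [c <= 2 * cost + 4],
    leaving at most [2t] darts without the edge of [d]. *)
Lemma short_detour d : d \in C ->
  ~~ connect (link r fc (C' d)) (fc d) None ->
  exists Y : {set D}, [/\ Y \subset ~: C, symmetric_darts r Y, #|Y| <= 2 * t
    & forall v, bdry tl Y v = (tl d == v) (+) (tl (r d) == v)].
Proof.
move=> dC; have sC' : symmetric_darts r (C' d) by exact: (del_edge_symmetric rK).
have := forest_edge_cut rK rN sC blocks_forest dC; rewrite -/(C' d).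
case dz0: (fc d) => [z0|]; last by rewrite connect0.
move=> ncut nN; pose K := [set z | connect (link r fc (C' d)) (Some z0) (Some z)].
set A := Some @: K.
have NA : None \notin A by apply/imsetP=> -[].
have AE o : (o \in A) = connect (link r fc (C' d)) (Some z0) o.
  case: o => [z|]; first by rewrite mem_imset ?inE // => ? ? [].
  by rewrite (negPf NA) (negPf nN).
have stepA b : b \in C' d -> (fc (r b) \in A) = (fc b \in A).
  move=> bC'; rewrite !AE.
  apply/esym/(same_connect_r (sym_connect_sym (link_sym fc rK sC'))).
  by apply: connect1; apply: link_dart.
have rdA : fc (r d) \notin A by rewrite AE; apply/negP.
have dA : fc d \in A by rewrite dz0 AE.
have exitA b : b \in C -> fc b \in A -> (fc (r b) \notin A) = (b == d).
  move=> bC bA; have [|nb] := boolP (b \in [set d; r d]).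
    case/set2P=> E; subst b; first by rewrite rdA eqxx.
    by rewrite bA in rdA.
  rewrite stepA; last by rewrite in_setD nb.
  rewrite bA; apply/esym/negbTE.
  by move: nb; rewrite !inE negb_or => /andP[].
have inner := card_inner_tree rK rN (@face_at_surj _ M) sC blocks_span
  blocks_forest NA dC dA exitA.
(* The only dart of [C] leaving the block is its exit, which would lead to the unreachable exterior
   face. *)
have KB : K \subset pblock P z0.
  apply/subsetP=> z; rewrite inE => z0z.
  pose S := [set o in Some @: pblock P z0 | connect (link r fc (C' d)) (Some z0) o].
  suff : Some z \in S by rewrite inE => /andP[/imsetP[z' z'B [->]]].
  apply: connect_closed z0z _; last by rewrite inE imset_f ?in_block /=.
  move=> a a'; rewrite inE => /andP[/imsetP[y yB ->] z0y] yl.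
  have z0a := connect_trans z0y (connect1 yl).
  rewrite inE z0a andbT; case/linkP: yl => b [bC' by_ ba].
  have [E|nb] := eqVneq b (xd (pblock P z0)).
    by rewrite -ba E xd_out ?block_in // (negPf nN) in z0a.
  have bC : b \in C by move: bC'; rewrite in_setD => /andP[].
  have [z' z'B E] := leave_block (block_in z0) bC by_ yB nb.
  by rewrite -ba E imset_f.
have costK : set_cost (@weight G M) K <= t - 1.
  apply: leq_trans costP; apply: leq_trans (leq_bigmax_cond _ (block_in z0)).
  rewrite /set_cost [X in _ <= X](big_setID K) /= (setIidPr KB).
  exact: leq_addr.
have dW : d \in cut r fc A by rewrite inE dA (negPf rdA).
have sW := cut_symmetric fc rK A.
exists (cut r fc A :\: [set d; r d]); split.
- apply/subsetP=> b; rewrite in_setD in_setC => /andP[nb bW].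
  apply: contraL bW => bC; rewrite inE stepA ?addbb //.
  by rewrite in_setD nb.
- exact: (del_edge_symmetric rK).
- have cA : #|A| = #|K| by apply: card_imset => ? ? [].
  (* An inequality is enough: further inner darts only make the cut smaller. *)
  have leN : #|[set b in C | (fc b \in A) && (fc (r b) \in A)]| <=
      #|[set b | (fc b \in A) && (fc (r b) \in A)]|.
    by apply: subset_leq_card; apply/subsetP=> b; rewrite !inE => /andP[].
  have := sum_face_sizes K; rewrite -/A -weight_card.
  have := cardsID [set d; r d] (cut r fc A).
  rewrite (setIidPr (edge_sub sW dW)) card_edge; last exact: rN.
  rewrite cA in inner; move: leN inner costK t_gt0.
  set c := #|cut r fc A|; set c' := #|cut r fc A :\: _|.
  set n := #|[set b in C | _]|; set n' := #|[set b | _]|.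
  set k := #|K|; set w := set_cost _ _.
  move: c c' n n' k w => c c' n n' k w; lia.
- move=> v; rewrite -(sdiff_edge sW dW) bdry_sdiff bdry_edge; last exact: rN.
  rewrite (cut_even (s := rot M)) //; first exact: perm_inj.
    exact: tail_rot.
  exact: face_at_rot.
Qed.

(** Removing an edge of the dual tree cuts one of its two sides off from the exterior face; [d] is
    reversed when that is the side of [r d]. *)
Lemma tree_stretch d : exists p,
  [/\ path (link r tl (~: C)) (tl d) p, last (tl d) p = tl (r d) & size p <= t].
Proof.
have [dC|dC] := boolP (d \in C); last first.
  by exists [:: tl (r d)]; rewrite /= link_dart // in_setC.
suff [Y [YC sY cY bY]] : exists Y : {set D},
    [/\ Y \subset ~: C, symmetric_darts r Y, #|Y| <= 2 * t
    & forall v, bdry tl Y v = (tl d == v) (+) (tl (r d) == v)].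
  have [p [pP lp sp]] := trail rK rN sY bY.
  exists p; split=> //; last by lia.
  by apply: sub_path pP; apply: link_sub.
have [con|/(short_detour dC)//] := boolP (connect (link r fc (C' d)) (fc d) None).
have rdC : r d \in C by rewrite sC.
have C'E : C' (r d) = C' d by rewrite /C' rev_dartK setUC.
have [|Y [YC sY cY bY]] := short_detour rdC.
  rewrite C'E; apply/negP=> con'.
  apply: (forest_edge_cut rK rN sC blocks_forest dC).
  apply: connect_trans con _; rewrite (sym_connect_sym (link_sym fc rK _)) //.
  exact: (del_edge_symmetric rK).
by exists Y; split=> // v; rewrite bY rev_dartK addbC.
Qed.

Lemma exits_spanner : exists F, tree_spanner t F.
Proof.
pose F : {set {set G}} := [set edge_of d | d in ~: C]; exists F.
have FE : darts_of F = ~: C.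
  apply/setP=> d; rewrite inE; apply/imsetP/idP => [[b bC /eqP]|dC].
    rewrite edge_of_eq => /orP[]/eqP E; move: bC; rewrite E //.
    by rewrite !in_setC sC.
  by exists d.
have [spT fT] := dual_tree_cotree connG sC blocks_span blocks_forest.
have tF : is_tree (spanning_subgraph F) by apply: darts_spanning_tree; rewrite FE.
split=> //.
  by rewrite edges_darts; apply: imsetS; apply: subsetT.
move=> u v; have /walkP[p [up lp <-]] := dist_walk (connG u v).
(* Each edge of a shortest walk in [G] is replaced by its detour in the tree. *)
suff [q [uq lq sq]] : exists q, [/\ path (@adj (spanning_subgraph F)) u q,
    last u q = v & size q <= t * size p].
  by apply: leq_trans sq; apply: dist_le; apply/walkP; exists q.
elim: p u up lp => [|a p IH] u /=; first by exists [::]; rewrite ?muln0.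
case/andP=> /dart_between[d [du da]] ap lp.
have [q [aq lq sq]] := IH a ap lp.
have [q' [uq' lq' sq']] := tree_stretch d.
exists (q' ++ q); rewrite cat_path last_cat -du lq' da lq mulnS size_cat leq_add //.
by rewrite aq andbT -(eq_path (link_darts_of F)) FE.
Qed.

End ExitDarts.

Lemma partition_spanner : exists F, tree_spanner t F.
Proof.
have [xd xdP] := exit_choice.
by apply: (@exits_spanner xd) => B /xdP[].
Qed.

End PartitionToSpanner.
End Spanners.

Theorem theorem3 (G : sgraph) (M : outerplane_embedding G) (t : nat) :
  two_connected G ->
  0 < t ->
  (exists F : {set {set G}}, tree_spanner t F) <->
  (exists P : {set {set weak_dual M}},
     tree_partition (E_faces M) P /\
     partition_cost (@weight G M) P <= t - 1).
Proof.
move=> [_ [_ connG] _] t_gt0; split=> [[F [_ tF stretch]]|[P [treeP costP]]].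
  have [spF fF] := spanning_tree_darts tF.
  apply: (@spanner_partition G M connG (darts_of F) t) => //.
    exact: darts_of_symmetric.
  move=> d; have [[_ con] _] := tF.
  have /walkP[p [dp lp sp]] := dist_walk (con (tail d) (tail (rev_dart d))).
  exists p; split=> //.
    by rewrite (eq_path (link_darts_of F)).
  (* The ends of an edge have distance at most 1 in [G], so their tree distance is at most [t]. *)
  rewrite sp; apply: leq_trans (stretch _ _) _.
  rewrite -[X in _ <= X]muln1 leq_mul2l; apply/orP; right; apply: dist_le.
  apply/walkP; exists [:: tail (rev_dart d)]; split=> //=.
  by rewrite andbT; exact: (valP d).
exact: (@partition_spanner G M connG P t treeP costP t_gt0).
Qed.
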